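(* Let $\mathcal{H}$ be a complex Hilbert space and let $A\in\mathcal{B}(\mathcal{H})$. Then $$\frac14\|A^*A+AA^*\| \le \frac18\left(\|A+A^*\|^2+\|A-A^*\|^2\right) \le \frac18\left(\|A+A^*\|^2+\|A-A^*\|^2\right)+\frac18 c^2(A+A^* )+\frac18 c^2(A-A^* ) \le w^2(A).$$
   Context: $\mathcal{B}(\mathcal{H})$ is the set of bounded linear operators on $\mathcal{H}$, $A^*$ is the adjoint of $A$, and $\|\cdot\|$ is the operator norm. The numerical radius is $w(A)=\sup\{|\langle Ax,x\rangle| : x\in\mathcal{H},\ \|x\|=1\}$ and the Crawford number is $c(A)=\inf\{|\langle Ax,x\rangle| : x\in\mathcal{H},\ \|x\|=1\}$. Here $w^2(A)=(w(A))^2$ and $c^2(A)=(c(A))^2$. *)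

(* Defs.v *)
From HB Require Import structures.
From mathcomp Require Import all_boot all_order all_algebra.
From mathcomp Require Import complex.
From mathcomp Require Import all_classical all_reals all_analysis.

Set Implicit Arguments.
Unset Strict Implicit.
Unset Printing Implicit Defensive.

Import Order.TTheory GRing.Theory Num.Theory.
Import numFieldNormedType.Exports.

Local Open Scope classical_set_scope.
Local Open Scope ring_scope.
Local Open Scope complex_scope.

(* [{dot V for Num.conj}] is linear in its first argument and conjugate-linear
   in its second one. *)
HB.mixin Record CompleteNormedModule_isHilbert (R : realType) V
    of CompleteNormedModule R[i] V := {
  inner : {dot V for (@Num.conj R[i])} ;
  inner_normE : forall x : V, `|x| ^+ 2 = inner x x
}.

#[short(type="hilbertType")]
HB.structure Definition Hilbert (R : realType) :=
  {V of CompleteNormedModule R[i] V & CompleteNormedModule_isHilbert R V}.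

Section Operators.
Context {R : realType} {H : hilbertType R}.
Implicit Types T : H -> H.

(* Norms over [R[i]] take their values in [R[i]]; they are real, so nothing is
   lost by taking real parts, which makes [sup] and [inf] available. *)
Definition opnorm T : R := sup [set complex.Re `|T x| | x in [set x : H | `|x| <= 1]].

(* On the zero space the unit sphere is empty, and the conventions
   [sup set0 = 0] and [inf set0 = 0] apply to the next two definitions. *)
Definition numerical_radius T : R :=
  sup [set complex.Re `|inner (T x) x| | x in [set x : H | `|x| = 1]].

Definition crawford_number T : R :=
  inf [set complex.Re `|inner (T x) x| | x in [set x : H | `|x| = 1]].

(* For a bounded linear [T], the vector below exists by the Riesz
   representation theorem, and it is unique; the default value [0] is only
   used for other functions [T]. *)
Definition adjoint T : H -> H :=
  fun y => xget 0 [set z | forall x, inner (T x) y = inner x z].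

End Operators.

(* Main.v *)
(* Write S = A + A^*, D = A - A^*.  The first inequality follows from
   2 (A^* A + A A^* ) = S S - D D.  For the last one, the two numbers <S x, x>
   and <D x, x> are twice the real part and 2i times the imaginary part of
   <A x, x>, so for every unit vector x
     |<S x, x>|^2 + |<D x, x>|^2 = 4 |<A x, x>|^2 <= 4 w(A)^2.
   Bounding one summand below by a Crawford number and taking the supremum of
   the other one, which is a squared operator norm because S and iD are
   self-adjoint, gives
     |S|^2 + c(D)^2 <= 4 w(A)^2  and  |D|^2 + c(S)^2 <= 4 w(A)^2,
   and the claim is the average of these two. *)
Require Import Defs.
From HB Require Import structures.
From mathcomp Require Import all_boot all_order all_algebra.
From mathcomp Require Import complex.
From mathcomp Require Import all_classical all_reals all_analysis.
From mathcomp Require Import ring lra.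
Import Order.TTheory GRing.Theory Num.Theory.
Import numFieldNormedType.Exports.
Local Open Scope classical_set_scope.
Local Open Scope ring_scope.

Section HilbertSpace.
Context {R : realType} {H : hilbertType R}.
Local Open Scope complex_scope.
Implicit Types (x y z : H) (t : R) (T : H -> H).

(** * Real-valued norm and real part of the inner product *)

Definition rnorm x : R := complex.Re `|x|.
Definition rinner x y : R := complex.Re (inner x y).

Lemma Re_normc_ge0 (z : R[i]) : 0 <= complex.Re `|z|.
Proof. by rewrite -ler0c RRe_real. Qed.

Lemma rnormE x : `|x| = (rnorm x)%:C.
Proof. by rewrite /rnorm RRe_real// normr_real. Qed.

Lemma rnorm_ge0 x : 0 <= rnorm x.
Proof. by rewrite -ler0c -rnormE. Qed.

Lemma rnorm0 : rnorm 0 = 0.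
Proof. by rewrite /rnorm normr0. Qed.

Lemma rnorm_eq0 x : (rnorm x == 0) = (x == 0).
Proof. by rewrite -[x == 0]normr_eq0 rnormE eq_complex /= eqxx andbT. Qed.

Lemma rnormZ (a : R[i]) x : rnorm (a *: x) = complex.Re `|a| * rnorm x.
Proof. by rewrite /rnorm normrZ (rnormE x) normc_def /= mulr0 subr0. Qed.

Lemma rnormZr t x : rnorm (t%:C *: x) = `|t| * rnorm x.
Proof. by rewrite rnormZ normc_def/= expr0n addr0 sqrtr_sqr. Qed.

Lemma rnormZi x : rnorm ('i *: x) = rnorm x.
Proof. by rewrite rnormZ normc_def/= expr0n add0r expr1n sqrtr1 mul1r. Qed.

Lemma rnormD x y : rnorm (x + y) <= rnorm x + rnorm y.
Proof. by have := ler_normD x y; rewrite !rnormE -rmorphD lecR. Qed.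

Lemma rnormN x : rnorm (- x) = rnorm x.
Proof. by rewrite /rnorm normrN. Qed.

Lemma rnormMn x n : rnorm (x *+ n) = rnorm x *+ n.
Proof. by rewrite /rnorm normrMn raddfMn. Qed.

Lemma innerC x y : inner y x = (inner x y)^*.
Proof. by rewrite hermC expr0 mul1r. Qed.

Lemma innerDl x y z : inner (x + y) z = inner x z + inner y z.
Proof. exact: linearDl. Qed.

Lemma innerBl x y z : inner (x - y) z = inner x z - inner y z.
Proof. exact: linearBl. Qed.

Lemma innerBr x y z : inner z (x - y) = inner z x - inner z y.
Proof. exact: linearBr. Qed.

Lemma innerZl (a : R[i]) x y : inner (a *: x) y = a * inner x y.
Proof. exact: linearZl_LR. Qed.

Lemma innerZr (a : R[i]) x y : inner x (a *: y) = a^* * inner x y.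
Proof. by rewrite innerC innerZl rmorphM/= -innerC. Qed.

Lemma innerxx x : inner x x = (rnorm x ^+ 2)%:C.
Proof. by rewrite -inner_normE rnormE rmorphXn. Qed.

Lemma rinnerxx x : rinner x x = rnorm x ^+ 2.
Proof. by rewrite /rinner innerxx. Qed.

Lemma rinnerC x y : rinner x y = rinner y x.
Proof. by rewrite /rinner innerC; case: (inner y x). Qed.

Lemma rinnerDl x y z : rinner (x + y) z = rinner x z + rinner y z.
Proof. by rewrite /rinner innerDl raddfD. Qed.

Lemma rinnerBl x y z : rinner (x - y) z = rinner x z - rinner y z.
Proof. by rewrite /rinner innerBl raddfB. Qed.

Lemma rinnerZl t x y : rinner (t%:C *: x) y = t * rinner x y.
Proof. by rewrite /rinner innerZl; case: (inner x y) => a b /=; ring. Qed.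

Lemma rinnerDr x y z : rinner z (x + y) = rinner z x + rinner z y.
Proof. by rewrite !(rinnerC z) rinnerDl. Qed.

Lemma rinnerBr x y z : rinner z (x - y) = rinner z x - rinner z y.
Proof. by rewrite !(rinnerC z) rinnerBl. Qed.

Lemma rinnerZr t x y : rinner y (t%:C *: x) = t * rinner y x.
Proof. by rewrite !(rinnerC y) rinnerZl. Qed.

(** Conjugate-linearity in the second argument turns ['i] into a factor -i, and Re (-i (a + ib)) =
    b. Hence the real form [rinner] determines all of [inner]. *)
Lemma rinner_ir x y : rinner x ('i *: y) = complex.Im (inner x y).
Proof. by rewrite /rinner innerZr; case: (inner x y) => a b /=; ring. Qed.

Lemma normc_inner_sqr x y :
  complex.Re `|inner x y| ^+ 2 = rinner x y ^+ 2 + rinner x ('i *: y) ^+ 2.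
Proof.
by rewrite rinner_ir normc_def/= sqr_sqrtr// addr_ge0// sqr_ge0.
Qed.

Lemma rnorm_sqrD x y :
  rnorm (x + y) ^+ 2 = rnorm x ^+ 2 + 2 * rinner x y + rnorm y ^+ 2.
Proof. by rewrite -!rinnerxx rinnerDl !rinnerDr (rinnerC y x); ring. Qed.

Lemma rnorm_sqrB x y :
  rnorm (x - y) ^+ 2 = rnorm x ^+ 2 - 2 * rinner x y + rnorm y ^+ 2.
Proof. by rewrite -!rinnerxx rinnerBl !rinnerBr (rinnerC y x); ring. Qed.

(** Cauchy-Schwarz comes from squaring the triangle inequality, which the norm already satisfies. *)
Lemma rinner_le x y : rinner x y <= rnorm x * rnorm y.
Proof.
have := rnormD x y; rewrite -(@ler_pXn2r _ 2%N) ?nnegrE ?addr_ge0 ?rnorm_ge0//.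
rewrite rnorm_sqrD; nra.
Qed.

Lemma rinner_abs_le x y : `|rinner x y| <= rnorm x * rnorm y.
Proof.
rewrite ler_norml rinner_le andbT lerNl -(rnormN x).
apply: le_trans (rinner_le _ _); rewrite /rinner.
by rewrite (linearNl (inner (s:=H))) raddfN.
Qed.

Lemma inner_eq x y : (forall z, rinner z x = rinner z y) -> x = y.
Proof.
move=> xy; apply/eqP; rewrite -subr_eq0 -rnorm_eq0 -sqrf_eq0 -rinnerxx.
by rewrite rinnerBr xy subrr.
Qed.

Lemma inner_eqP x y x' y' :
  rinner x y = rinner x' y' -> rinner x ('i *: y) = rinner x' ('i *: y') ->
  inner x y = inner x' y'.
Proof.
by rewrite !rinner_ir /rinner; move: (inner x y) (inner x' y');
   move=> [? ?] [? ?] /= -> ->.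
Qed.

(** * Completeness and Riesz representation *)

(** Radii in [H] live in [R[i]], but a positive element of [R[i]] is real, so real radii suffice. *)
Lemma rnorm_cauchy_cvg (u : nat -> H) :
  (forall e : R, 0 < e -> exists N, forall n, (N <= n)%N ->
    rnorm (u N - u n) < e) ->
  exists l, forall e : R, 0 < e -> \forall n \near \oo, rnorm (l - u n) < e.
Proof.
move=> uC.
have eR (e : R[i]) : 0 < e -> e = (complex.Re e)%:C /\ 0 < complex.Re e.
  by move=> e0; rewrite -ltcR RRe_real// gtr0_real.
have : cvg (u @ \oo).
  apply: cauchy_cvg; apply: cauchy_exP => e /eR[-> e0].
  have [N uN] := uC _ e0; exists (u N); exists N => // n /= Nn.
  by rewrite -ball_normE /= rnormE ltcR uN.
move=> /cvgrPdist_lt ul; exists (lim (u @ \oo)) => e e0.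
have := ul e%:C; rewrite ltcR => /(_ e0).
by apply: filterS => n; rewrite rnormE ltcR.
Qed.

(* The representing vector is the limit of a minimizing sequence of
   [|x|^2 - 2 F x], which is Cauchy by the parallelogram law. *)
Lemma riesz (F : H -> R) (M : R) :
  (forall x y, F (x + y) = F x + F y) ->
  (forall t x, F (t%:C *: x) = t * F x) ->
  (forall x, F x <= M * rnorm x) ->
  exists l, forall z, F z = rinner z l.
Proof.
move=> FD FZ FM; pose g x : R := rnorm x ^+ 2 - 2 * F x.
have g_inf : has_inf (range g).
  split; first by exists (g 0), 0.
  (* Complete the square: |x|^2 - 2 M |x| = (|x| - M)^2 - M^2. *)
  exists (- M ^+ 2) => _ [x _ <-]; have := FM x.
  by have := sqr_ge0 (rnorm x - M); rewrite /g; nra.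
set m := inf (range g).
have gm x : m <= g x by apply: ge_inf; [case: g_inf | exists x].
have /choice[u gu] n : exists x, g x < m + n.+1%:R^-1.
  have n0 : 0 < n.+1%:R^-1 :> R by rewrite invr_gt0.
  by have [_ [x _ <-] gx] := inf_adherent n0 g_inf; exists x.
have u_close n k : rnorm (u n - u k) ^+ 2 <= 2 * (n.+1%:R^-1 + k.+1%:R^-1).
  (* At the midpoint v, g (u n) + g (u k) - 2 g v = |u n - u k|^2 / 2, while g v >= m. *)
  have := gm ((2^-1)%:C *: (u n + u k)); have := gu n; have := gu k.
  rewrite /g rnormZr FZ FD ger0_norm ?invr_ge0// rnorm_sqrB exprMn rnorm_sqrD.
  by move: (n.+1%:R^-1) (k.+1%:R^-1) => p q; lra.
have inv_small (e : R) : 0 < e -> exists N, forall n, (N <= n)%N -> n.+1%:R^-1 < e.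
  move=> e0; have [N _ NP] := near_infty_natSinv_lt (PosNum e0).
  by exists N => n; exact: NP.
have [l ul] : exists l,
    forall e : R, 0 < e -> \forall n \near \oo, rnorm (l - u n) < e.
  apply: rnorm_cauchy_cvg => e e0.
  have [N NP] := inv_small (e ^+ 2 / 4) ltac:(rewrite divr_gt0// exprn_gt0//).
  exists N => n Nn; rewrite -(@ltr_pXn2r _ 2%N) ?nnegrE ?rnorm_ge0 ?ltW//.
  have := u_close N n; have := NP _ (leqnn N); have := NP _ Nn.
  by move: (N.+1%:R^-1) (n.+1%:R^-1) => p q; lra.
have half z : rinner z l <= F z.
  apply/ler_addgt0Pr => d d0.
  (* The error is at most e |z| for replacing [l] by [u n], plus e (|z|^2 + 1) / 2 from [gap], where
     the 1 stems from the slack e^2 in [gun]. The total is e K = d. *)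
  pose K := rnorm z + (rnorm z ^+ 2 + 1) / 2.
  have K0 : 0 < K.
    by rewrite ltr_wpDl ?rnorm_ge0// divr_gt0// ltr_wpDl// sqr_ge0.
  have e0 : 0 < d / K by rewrite divr_gt0.
  set e := d / K in e0.
  have [N NP] := inv_small (e ^+ 2) ltac:(rewrite exprn_gt0//).
  have [N' _ NP'] := ul _ e0.
  pose n := maxn N N'.
  have lun : rnorm (l - u n) < e by apply: NP'; rewrite /= leq_maxr.
  have gun : g (u n) < m + e ^+ 2.
    by apply: lt_trans (gu n) _; rewrite ltrD2l NP// leq_maxl.
  (* Compare the almost minimal value [g (u n)] with [g (u n - e z)]. *)
  have gap : rinner (u n) z - F z <= e * ((rnorm z ^+ 2 + 1) / 2).
    have := gm (u n + (- e)%:C *: z).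
    rewrite /g rnorm_sqrD FD FZ rinnerZr rnormZr normrN exprMn.
    rewrite real_normK ?num_real//.
    move: gun; rewrite /g => gun gm'; rewrite -(ler_pM2l e0); nra.
  have := rinner_le (l - u n) z; rewrite rinnerBl (rinnerC l).
  have := ler_wpM2r (rnorm_ge0 z) (ltW lun).
  suff : e * K = d by rewrite /K; lra.
  by rewrite /e divfK ?gt_eqF.
have {}half z : F z = rinner z l.
  apply/eqP; rewrite eq_le half andbT.
  (* Both sides are odd in z, so the inequality at -z is the converse one. *)
  have := half ((-1)%:C *: z); rewrite FZ rinnerZl; lra.
by exists l.
Qed.

(** * The adjoint of a bounded operator *)

Context (A : {linear H -> H}) (A_bounded : bounded_near A (nbhs (0 : H))).

Lemma rnorm_bounded : exists2 M, 0 <= M & forall x, rnorm (A x) <= M * rnorm x.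
Proof.
have /linear_boundedP/pinfty_ex_gt0[M M0 AM] := A_bounded.
exists (complex.Re M) => [|x].
  by rewrite -ler0c RRe_real ?ltW// gtr0_real.
by rewrite -lecR rmorphM/= -!rnormE RRe_real ?AM// gtr0_real.
Qed.

(** Riesz for the real functional Re <A x, y> supplies a vector matching real parts; replacing x by
    i x then matches imaginary parts. *)
Lemma adjointP x y : inner (A x) y = inner x (adjoint A y).
Proof.
move: x; apply: (@xgetPex _ 0 [set z | forall x, inner (A x) y = inner x z]).
have [M M0 AM] := rnorm_bounded.
have [] := @riesz (fun x => rinner (A x) y) (M * rnorm y).
- by move=> x x'; rewrite linearD rinnerDl.
- by move=> t x; rewrite linearZ rinnerZl.
- move=> x; apply: le_trans (rinner_le _ _) _.
  by rewrite mulrAC ler_wpM2r// rnorm_ge0.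
move=> l lP; exists l => x /=; apply: inner_eqP; first exact: lP.
have := lP ('i *: x); rewrite linearZ/= [in RHS]rinnerC [in LHS]rinnerC.
rewrite !rinner_ir (innerC (A x)) (innerC x).
by move: (inner (A x) y) (inner x l) => [? ?] [? ?] /= /oppr_inj.
Qed.

Lemma inner_adjointl x y : inner (adjoint A x) y = inner x (A y).
Proof. by rewrite innerC -adjointP -innerC. Qed.

Lemma rinner_adjoint x y : rinner (A x) y = rinner x (adjoint A y).
Proof. by rewrite /rinner adjointP. Qed.

Lemma rinner_adjointl x y : rinner (adjoint A x) y = rinner x (A y).
Proof. by rewrite rinnerC -rinner_adjoint rinnerC. Qed.

Lemma adjointD x y : adjoint A (x + y) = adjoint A x + adjoint A y.
Proof.
by apply: inner_eq => z; rewrite rinnerDr -!rinner_adjoint rinnerDr.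
Qed.

Lemma adjointB x y : adjoint A (x - y) = adjoint A x - adjoint A y.
Proof.
by apply: inner_eq => z; rewrite rinnerBr -!rinner_adjoint rinnerBr.
Qed.

Lemma adjointZ t x : adjoint A (t%:C *: x) = t%:C *: adjoint A x.
Proof.
by apply: inner_eq => z; rewrite rinnerZr -!rinner_adjoint rinnerZr.
Qed.

(** |A^* x|^2 = Re <A (A^* x), x> <= M |A^* x| |x|; then cancel |A^* x|. *)
Lemma rnorm_adjoint_le M x : (forall y, rnorm (A y) <= M * rnorm y) ->
  rnorm (adjoint A x) <= M * rnorm x.
Proof.
move=> AM; have [->|] := eqVneq (adjoint A x) 0.
  by rewrite rnorm0 (le_trans (rnorm_ge0 _) (AM x)).
rewrite -rnorm_eq0 => n0.
rewrite -(@ler_pM2l _ (rnorm (adjoint A x))) ?lt_def ?n0 ?rnorm_ge0//.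
rewrite -expr2 -rinnerxx -rinner_adjoint (le_trans (rinner_le _ _))//.
by rewrite mulrA (mulrC _ M) ler_wpM2r ?rnorm_ge0.
Qed.

(** * Self-adjoint operators and their quadratic forms *)

(* For real parts only; this already forces [T] to be additive and
   real-homogeneous. *)
Definition selfadjoint T := forall x y, rinner (T x) y = rinner x (T y).

Lemma selfadjointD T x y : selfadjoint T -> T (x + y) = T x + T y.
Proof. by move=> Ts; apply: inner_eq => z; rewrite rinnerDr -!Ts rinnerDr. Qed.

Lemma selfadjointB T x y : selfadjoint T -> T (x - y) = T x - T y.
Proof. by move=> Ts; apply: inner_eq => z; rewrite rinnerBr -!Ts rinnerBr. Qed.

Lemma selfadjointZ T t x : selfadjoint T -> T (t%:C *: x) = t%:C *: T x.
Proof. by move=> Ts; apply: inner_eq => z; rewrite rinnerZr -!Ts rinnerZr. Qed.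

(** For y = t T x, the difference of the forms at x + y and x - y is 4 t |T x|^2, and the
    parallelogram law bounds it by 2 K (|x|^2 + |y|^2). The choice t = 1 / K is optimal. *)
Lemma selfadjoint_rnorm_le T K : selfadjoint T -> 0 <= K ->
  (forall x, `|rinner (T x) x| <= K * rnorm x ^+ 2) ->
  forall x, rnorm (T x) <= K * rnorm x.
Proof.
move=> Ts K0 TK x.
(* Polarization between [x] and [t T x]. *)
have bound t : 2 * t * rnorm (T x) ^+ 2
    <= K * (rnorm x ^+ 2 + t ^+ 2 * rnorm (T x) ^+ 2).
  pose y := t%:C *: T x.
  have := le_trans (ler_norm _) (TK (x + y)).
  have : - rinner (T (x - y)) (x - y) <= K * rnorm (x - y) ^+ 2.
    by apply: le_trans (TK _); rewrite -normrN ler_norm.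
  rewrite rnorm_sqrB rnorm_sqrD (selfadjointB _ x y Ts) (selfadjointD _ x y Ts).
  rewrite !(rinnerBl, rinnerDl, rinnerBr, rinnerDr) (Ts y x) (rinnerC y).
  rewrite rnormZr exprMn real_normK ?num_real// {1 2 5 6}/y.
  rewrite rinnerZr rinnerxx; lra.
rewrite -(@ler_pXn2r _ 2%N) ?nnegrE ?mulr_ge0 ?rnorm_ge0// exprMn.
move: K0; rewrite le_eqVlt => /predU1P[K0|K0].
  (* For K = 0 any positive t forces T x = 0. *)
  have := bound 1; rewrite -K0; lra.
have bK := bound K^-1; rewrite -(ler_pM2l K0) in bK; move: bK.
have -> : K * (2 * K^-1 * rnorm (T x) ^+ 2) = 2 * rnorm (T x) ^+ 2.
  by field; rewrite gt_eqF.
have -> : K * (K * (rnorm x ^+ 2 + K^-1 ^+ 2 * rnorm (T x) ^+ 2)) =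
    K ^+ 2 * rnorm x ^+ 2 + rnorm (T x) ^+ 2 by field; rewrite gt_eqF.
lra.
Qed.

(** * The operator norm *)

Lemma opnorm_le T K : 0 <= K -> (forall x, rnorm (T x) <= K * rnorm x) ->
  opnorm T <= K.
Proof.
move=> K0 TK; apply: ge_sup => [|_ [x /= x1 <-]].
  by exists (rnorm (T 0)), 0; rewrite //= normr0.
apply: le_trans (TK x) _; rewrite ler_piMr//.
by move: x1; rewrite rnormE -[1]/(1%:C) lecR.
Qed.

(** A real [sup] is meaningful only for a set bounded above; this provides the bound whenever
    [opnorm] is used from below. *)
Lemma opnorm_has_ubound T M : (forall x, rnorm (T x) <= M * rnorm x) ->
  has_ubound [set complex.Re `|T x| | x in [set x : H | `|x| <= 1]].
Proof.
move=> TM; exists `|M| => _ [y /= y1 <-]; apply: le_trans (TM y) _.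
apply: le_trans (ler_wpM2r (rnorm_ge0 y) (ler_norm M)) _.
by rewrite ler_piMr//; move: y1; rewrite rnormE -[1]/(1%:C) lecR.
Qed.

Lemma rnorm_le_opnorm T M : (forall t x, T (t%:C *: x) = t%:C *: T x) ->
  (forall x, rnorm (T x) <= M * rnorm x) ->
  forall x, rnorm (T x) <= opnorm T * rnorm x.
Proof.
move=> TZ TM x; have [x0|x0] := eqVneq (rnorm x) 0.
  by have := TM x; rewrite x0 !mulr0.
have xgt0 : 0 < rnorm x by rewrite lt_def x0 rnorm_ge0.
rewrite -ler_pdivrMr// mulrC -[(rnorm x)^-1]ger0_norm ?invr_ge0 ?rnorm_ge0//.
rewrite -rnormZr -TZ; apply: ub_le_sup.
  exact: opnorm_has_ubound TM.
exists ((rnorm x)^-1%:C *: x) => //=.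
by rewrite rnormE rnormZr -[1]/(1%:C) lecR ger0_norm ?invr_ge0 ?rnorm_ge0// mulVf.
Qed.

Lemma opnorm_ge0 T M : (forall x, rnorm (T x) <= M * rnorm x) -> 0 <= opnorm T.
Proof.
move=> TM; apply: le_trans (rnorm_ge0 (T 0)) _; apply: ub_le_sup.
  exact: opnorm_has_ubound TM.
by exists 0; rewrite //= normr0.
Qed.

(** Homogeneity spreads the bound from unit vectors to all vectors with constant sqrt k, and
    [selfadjoint_rnorm_le] applies. The sign of k is a hypothesis because the unit sphere may be
    empty. *)
Lemma selfadjoint_opnorm_sqr_le T (k : R) : selfadjoint T -> 0 <= k ->
  (forall x, rnorm x = 1 -> rinner (T x) x ^+ 2 <= k) -> opnorm T ^+ 2 <= k.
Proof.
move=> Ts k0 Tk.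
have TK x : `|rinner (T x) x| <= Num.sqrt k * rnorm x ^+ 2.
  have [->|] := eqVneq x 0.
    by rewrite rnorm0 expr0n mulr0 /rinner linear0r normr0.
  rewrite -rnorm_eq0 => x0.
  have xgt0 : 0 < rnorm x by rewrite lt_def x0 rnorm_ge0.
  rewrite -ler_pdivrMr ?exprn_gt0// -(@ler_pXn2r _ 2%N)
    ?nnegrE ?divr_ge0 ?sqrtr_ge0 ?exprn_ge0 ?rnorm_ge0//.
  rewrite sqr_sqrtr// exprMn real_normK ?num_real//.
  have := Tk ((rnorm x)^-1%:C *: x); rewrite selfadjointZ// rinnerZl rinnerZr.
  rewrite rnormZr ger0_norm ?invr_ge0 ?rnorm_ge0//.
  rewrite mulVf// => /(_ erefl).
  by apply: le_trans; rewrite le_eqVlt -exprVn; apply/orP; left; apply/eqP; ring.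
have TN := selfadjoint_rnorm_le _ _ Ts (sqrtr_ge0 k) TK.
rewrite -[leRHS]sqr_sqrtr// ler_pXn2r ?nnegrE ?sqrtr_ge0 ?(opnorm_ge0 _ _ TN)//.
exact: opnorm_le (sqrtr_ge0 k) TN.
Qed.

(** * The operators A + A^* and A - A^* *)

Lemma selfadjoint_real_part : selfadjoint (A \+ adjoint A).
Proof.
move=> x y /=.
by rewrite rinnerDl rinnerDr rinner_adjoint rinner_adjointl addrC.
Qed.

(** A - A^* is skew-adjoint, and the factor i, harmless for norms, makes it self-adjoint: the result
    is -2 Im A. *)
Lemma selfadjoint_imaginary_part :
  selfadjoint (fun x => 'i *: (A \- adjoint A) x).
Proof.
move=> x y /=; rewrite rinnerC !rinner_ir !innerBr -!adjointP.
rewrite (innerC (A x) y) (innerC (A y) x).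
by move: (inner (A x) y) (inner (A y) x) => [? ?] [? ?] /=; ring.
Qed.

Lemma opnormZi T : opnorm (fun x => 'i *: T x) = opnorm T.
Proof.
rewrite /opnorm; congr (sup _); apply/seteqP.
by split=> _ [x x1 <-]; exists x => //; rewrite -!/(rnorm _) rnormZi.
Qed.

Lemma inner_real_part x :
  complex.Re `|inner ((A \+ adjoint A) x) x| ^+ 2 = (2 * rinner (A x) x) ^+ 2.
Proof.
rewrite innerDl inner_adjointl (innerC (A x) x) /rinner.
case: (inner (A x) x) => a b; rewrite normc_def/=.
by rewrite sqr_sqrtr ?addr_ge0 ?sqr_ge0//; ring.
Qed.

Lemma inner_imaginary_part x :
  complex.Re `|inner ((A \- adjoint A) x) x| ^+ 2 =
  (2 * rinner (A x) ('i *: x)) ^+ 2.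
Proof.
rewrite innerBl inner_adjointl (innerC (A x) x) rinner_ir.
case: (inner (A x) x) => a b; rewrite normc_def/=.
by rewrite sqr_sqrtr ?addr_ge0 ?sqr_ge0//; ring.
Qed.

Lemma rinner_imaginary_part x :
  rinner ('i *: (A \- adjoint A) x) x = - (2 * rinner (A x) ('i *: x)).
Proof.
rewrite rinner_ir /rinner innerZl innerBl inner_adjointl (innerC (A x) x).
by case: (inner (A x) x) => a b /=; ring.
Qed.

(** * Numerical radius and Crawford number *)

Lemma numerical_radius_ge x : rnorm x = 1 ->
  rinner (A x) x ^+ 2 + rinner (A x) ('i *: x) ^+ 2 <= numerical_radius A ^+ 2.
Proof.
move=> x1; rewrite -normc_inner_sqr.
have le_w : complex.Re `|inner (A x) x| <= numerical_radius A.
  apply: ub_le_sup; last by exists x; rewrite //= rnormE x1.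
  have [M M0 AM] := rnorm_bounded.
  (* A crude bound making the supremum finite: the real and imaginary parts of <A y, y> are each at
     most M in absolute value. *)
  exists (Num.sqrt (M ^+ 2 + M ^+ 2)) => _ [y /= y1 <-].
  have {}y1 : rnorm y = 1 by rewrite /rnorm y1.
  rewrite -(@ler_pXn2r _ 2%N) ?nnegrE ?sqrtr_ge0 ?Re_normc_ge0//.
  rewrite normc_inner_sqr sqr_sqrtr ?addr_ge0 ?sqr_ge0//.
  have sqr_le z : rnorm z = 1 -> rinner (A y) z ^+ 2 <= M ^+ 2.
    move=> z1; rewrite -real_normK ?num_real// ler_pXn2r ?nnegrE//.
    apply: le_trans (rinner_abs_le _ _) _; rewrite z1 mulr1.
    by rewrite (le_trans (AM y))// y1 mulr1.
  by rewrite lerD ?sqr_le ?rnormZi.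
have w_ge0 := le_trans (Re_normc_ge0 _) le_w.
by apply: lerXn2r le_w; rewrite nnegrE ?Re_normc_ge0.
Qed.

Lemma crawford_number_ge0 T : 0 <= crawford_number T.
Proof.
rewrite /crawford_number; set E := (X in inf X).
have [->|/set0P E0] := eqVneq E set0; first by rewrite inf0.
by apply: lb_le_inf => // _ [x _ <-]; exact: Re_normc_ge0.
Qed.

Lemma crawford_number_sqr_le T x : rnorm x = 1 ->
  crawford_number T ^+ 2 <= complex.Re `|inner (T x) x| ^+ 2.
Proof.
move=> x1; rewrite ler_pXn2r ?nnegrE ?crawford_number_ge0 ?Re_normc_ge0//.
apply: ge_inf; last by exists x; rewrite //= rnormE x1.
by exists 0 => _ [y _ <-]; exact: Re_normc_ge0.
Qed.

Lemma crawford_number_unit_sphere0 T :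
  ~ (exists x : H, rnorm x = 1) -> crawford_number T = 0.
Proof.
move=> no_unit; rewrite /crawford_number [X in inf X](_ : _ = set0) ?inf0//.
apply/seteqP; split=> // _ [x /= x1 _]; apply: no_unit; exists x.
by rewrite /rnorm x1.
Qed.

(** * The norm inequalities *)

Lemma opnorm_real_part_sqr_le :
  opnorm (A \+ adjoint A) ^+ 2 + crawford_number (A \- adjoint A) ^+ 2 <=
  4 * numerical_radius A ^+ 2.
Proof.
set c := crawford_number _; set w := numerical_radius A.
have unit_le x : rnorm x = 1 ->
    rinner ((A \+ adjoint A) x) x ^+ 2 <= 4 * w ^+ 2 - c ^+ 2.
  move=> x1; have := crawford_number_sqr_le (A \- adjoint A) _ x1.
  rewrite inner_imaginary_part rinnerDl rinner_adjointl (rinnerC x).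
  by have := numerical_radius_ge _ x1; rewrite -/c -/w; lra.
rewrite -lerBrDr; apply: selfadjoint_opnorm_sqr_le => //.
  exact: selfadjoint_real_part.
(* It remains that 4 w^2 - c^2 >= 0: any unit vector shows it, and without one c takes its default
   value 0. *)
have [[x x1]|no_unit] := pselect (exists x : H, rnorm x = 1).
  exact: le_trans (sqr_ge0 _) (unit_le _ x1).
by rewrite /c crawford_number_unit_sphere0// expr0n subr0 mulr_ge0 ?sqr_ge0.
Qed.

Lemma opnorm_imaginary_part_sqr_le :
  opnorm (A \- adjoint A) ^+ 2 + crawford_number (A \+ adjoint A) ^+ 2 <=
  4 * numerical_radius A ^+ 2.
Proof.
set c := crawford_number _; set w := numerical_radius A.
have unit_le x : rnorm x = 1 ->
    rinner ('i *: (A \- adjoint A) x) x ^+ 2 <= 4 * w ^+ 2 - c ^+ 2.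
  move=> x1; have := crawford_number_sqr_le (A \+ adjoint A) _ x1.
  rewrite inner_real_part rinner_imaginary_part.
  by have := numerical_radius_ge _ x1; rewrite -/c -/w; lra.
rewrite -lerBrDr -opnormZi; apply: selfadjoint_opnorm_sqr_le => //.
  exact: selfadjoint_imaginary_part.
have [[x x1]|no_unit] := pselect (exists x : H, rnorm x = 1).
  exact: le_trans (sqr_ge0 _) (unit_le _ x1).
by rewrite /c crawford_number_unit_sphere0// expr0n subr0 mulr_ge0 ?sqr_ge0.
Qed.

Lemma opnorm_sum_products_le :
  2 * opnorm ((adjoint A \o A) \+ (A \o adjoint A)) <=
  opnorm (A \+ adjoint A) ^+ 2 + opnorm (A \- adjoint A) ^+ 2.
Proof.
set S := A \+ adjoint A; set D := A \- adjoint A.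
have [M M0 AM] := rnorm_bounded.
have tAM x := rnorm_adjoint_le M x AM.
have SM x : rnorm (S x) <= (M + M) * rnorm x.
  by rewrite mulrDl (le_trans (rnormD _ _))// lerD.
have DM x : rnorm (D x) <= (M + M) * rnorm x.
  by rewrite mulrDl (le_trans (rnormD _ _))// rnormN lerD.
have SZ t x : S (t%:C *: x) = t%:C *: S x by rewrite /S /= linearZ adjointZ scalerDr.
have DZ t x : D (t%:C *: x) = t%:C *: D x by rewrite /D /= linearZ adjointZ scalerBr.
have S_le := rnorm_le_opnorm _ _ SZ SM; have D_le := rnorm_le_opnorm _ _ DZ DM.
have S0 := opnorm_ge0 _ _ SM; have D0 := opnorm_ge0 _ _ DM.
rewrite -ler_pdivlMl//; apply: opnorm_le => [|x].
  by rewrite mulr_ge0 ?invr_ge0 ?addr_ge0 ?sqr_ge0.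
rewrite -(ler_pM2l (ltr0n R 2)) !mulrA divff// mul1r.
have -> : 2 * rnorm (((adjoint A \o A) \+ (A \o adjoint A)) x) =
    rnorm (S (S x) - D (D x)).
  rewrite mulr_natl -rnormMn mulr2n; congr rnorm.
  rewrite /S /D /= (linearD A) (linearB A) adjointD adjointB.
  (* With the four products generalized, this is an identity in an abelian group: the squares of A
     and A^* cancel and the mixed products double. *)
  move: (A (A x)) (A (adjoint A x)) (adjoint A (A x)) (adjoint A (adjoint A x)).
  move=> p q r s; rewrite 2!opprB (addrC (r - s)) [RHS]addrACA (addrC p q).
  rewrite [X in _ = X + _]addrACA [X in _ = _ + X]addrACA !subrr !addr0.
  by rewrite [LHS]addrACA addrC.
(* Each of S and D is applied twice, so its operator norm enters squared. *)
apply: le_trans (rnormD _ _) _; rewrite rnormN mulrDl lerD//.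
  by rewrite expr2 -mulrA (le_trans (S_le _))// ler_wpM2l.
by rewrite expr2 -mulrA (le_trans (D_le _))// ler_wpM2l.
Qed.

End HilbertSpace.

Theorem theorem2p1 (R : realType) (H : hilbertType R)
    (A : {linear H -> H}) (A_bounded : bounded_near A (nbhs (0 : H))) :
  [/\ 4^-1 * opnorm ((adjoint A \o A) \+ (A \o adjoint A))
        <= 8^-1 * (opnorm (A \+ adjoint A) ^+ 2 + opnorm (A \- adjoint A) ^+ 2),
      8^-1 * (opnorm (A \+ adjoint A) ^+ 2 + opnorm (A \- adjoint A) ^+ 2)
        <= 8^-1 * (opnorm (A \+ adjoint A) ^+ 2 + opnorm (A \- adjoint A) ^+ 2)
           + 8^-1 * crawford_number (A \+ adjoint A) ^+ 2
           + 8^-1 * crawford_number (A \- adjoint A) ^+ 2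
    & 8^-1 * (opnorm (A \+ adjoint A) ^+ 2 + opnorm (A \- adjoint A) ^+ 2)
        + 8^-1 * crawford_number (A \+ adjoint A) ^+ 2
        + 8^-1 * crawford_number (A \- adjoint A) ^+ 2
        <= numerical_radius A ^+ 2].
Proof.
split.
- by have := opnorm_sum_products_le _ A_bounded; lra.
- by have := sqr_ge0 (crawford_number (A \+ adjoint A));
     have := sqr_ge0 (crawford_number (A \- adjoint A)); lra.
- by have := opnorm_real_part_sqr_le _ A_bounded;
     have := opnorm_imaginary_part_sqr_le _ A_bounded; lra.
Qed.
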